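(* Let $f=\mathbb{E}_\xi[f_\xi]$ be $L_{f/h}$-relatively smooth with respect to $h$ (no relative strong convexity assumed), with minimizer $x^\star\in\operatorname{int}\operatorname{dom}h$ satisfying $\nabla f(x^\star)=0$, and suppose the noise assumption below holds with constant $\sigma^2$ and step size $\eta\le1/(2L_{f/h})$. Then the iterates of Bregman stochastic gradient descent with constant step size $\eta$ satisfy, for every $T\ge1$, $$\mathbb{E}\Big[\frac1T\sum_{t=0}^{T}D_f(x^\star,x_t)\Big]\le\frac{D_h(x^\star,x_0)}{\eta T}+\eta\sigma^2.$$
   Context: Let $C\subseteq\mathbb{R}^d$ be a closed convex set and $h:\mathbb{R}^d\to\mathbb{R}\cup\{+\infty\}$ a function satisfying the standing assumption: $h$ is twice continuously differentiable and strictly convex on $\operatorname{int} C$, and for every $y\in\mathbb{R}^d$ the problem $\min_{x\in C} h(x)-x^\top y$ has a unique solution, which lies in $\operatorname{int} C$. $h^*$ is the convex conjugate of $h$. For differentiable $\varphi$, $D_\varphi(x,y)=\varphi(x)-\varphi(y)-\nabla\varphi(y)^\top(x-y)$. A differentiable $f$ is $L$-relatively smooth w.r.t. $h$ if $D_f(x,y)\le L D_h(x,y)$ for all $x,y\in\operatorname{int}\operatorname{dom}h$. Bregman stochastic gradient descent (BSGD): given $x_0\in\operatorname{int}C$, $x_{t+1}=\arg\min_{x\in C}\{\eta g_t^\top x+D_h(x,x_t)\}$, equivalently $\nabla h(x_{t+1})=\nabla h(x_t)-\eta g_t$, where $g_t=\nabla f_{\xi_t}(x_t)$ and $\xi_t$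 are drawn independently from the distribution of $\xi$. Noise assumption: every $f_\xi$ is convex and $L_{f/h}$-relatively smooth w.r.t. $h$, $\mathbb{E}_\xi[f_\xi]=f$, and there is $\sigma^2\ge0$ such that for all $t$, $\sigma^2\ge\frac{1}{2\eta^2}\mathbb{E}_{\xi_t}\big[D_{h^*}(\nabla h(x_t)-2\eta\nabla f_{\xi_t}(x^\star),\nabla h(x_t))\big]$. *)

(* Defs.v *)
From HB Require Import structures.
From mathcomp Require Import all_boot all_order all_algebra.
From mathcomp Require Import all_classical all_reals all_analysis.

Set Implicit Arguments.
Unset Strict Implicit.
Unset Printing Implicit Defensive.

Import Order.TTheory GRing.Theory Num.Theory.
Import numFieldNormedType.Exports.

Local Open Scope classical_set_scope.
Local Open Scope ring_scope.

Section BregmanDefs.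
Variables (R : realType) (d : nat).

Definition dotp (x y : 'rV[R]_d) : R := \sum_(i < d) x 0 i * y 0 i.

Definition grad (phi : 'rV[R]_d -> R) (x : 'rV[R]_d) : 'rV[R]_d :=
  \row_(i < d) 'D_(delta_mx 0 i) phi x.

Definition bregman (phi : 'rV[R]_d -> R) (x y : 'rV[R]_d) : R :=
  phi x - phi y - dotp (grad phi y) (x - y).

Definition convex_on (A : set 'rV[R]_d) (phi : 'rV[R]_d -> R) : Prop :=
  forall x y (t : R), A x -> A y -> 0 <= t <= 1 ->
    phi (t *: x + (1 - t) *: y) <= t * phi x + (1 - t) * phi y.

Definition strictly_convex_on (A : set 'rV[R]_d) (h : 'rV[R]_d -> \bar R) : Prop :=
  forall x y (t : R), A x -> A y -> x != y -> 0 < t < 1 ->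
    (h (t *: x + (1 - t) *: y)%R < t%:E * h x + (1 - t)%:E * h y)%E.

Definition C2_on (A : set 'rV[R]_d) (phi : 'rV[R]_d -> R) : Prop :=
  [/\ forall x, A x -> differentiable phi x,
      forall v x, A x -> differentiable ('D_v phi) x &
      forall u v x, A x -> {for x, continuous ('D_u ('D_v phi))}].

Definition conjugate (h : 'rV[R]_d -> \bar R) (y : 'rV[R]_d) : \bar R :=
  ereal_sup [set ((dotp x y)%:E - h x)%E | x in [set: 'rV[R]_d]].

Definition rel_smooth (A : set 'rV[R]_d) (L : R) (phi hR : 'rV[R]_d -> R) : Prop :=
  forall x y, A x -> A y -> bregman phi x y <= L * bregman hR x y.

End BregmanDefs.

(* Expectation over i.i.d. samples xi_0, ..., xi_(n-1) of law P of a function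
   of the history [:: xi_0; ...; xi_(n-1)], as the iterated integral
   \int[P]_(xi_0) ... \int[P]_(xi_(n-1)) G [:: xi_0; ...; xi_(n-1)]. *)
Fixpoint iexp {dX : measure_display} {X : measurableType dX} {R : realType}
  (P : probability X R) (n : nat) (G : seq X -> \bar R) : \bar R :=
  match n with
  | 0 => G [::]
  | n'.+1 => (\int[P]_xi iexp P n' (fun s => G (xi :: s)))%E
  end.

(* Main.v *)
(** Write [gs := grad (F xi) xstar].  Since [grad hstar] inverts [grad h],
    [D_h(x_t, x_{t+1}) = D_hstar(grad h(x_t) - eta g_t, grad h(x_t))]; splitting
    [g_t = (g_t - gs) + gs] and using convexity of [hstar], the first half is
    controlled by Bregman cocoercivity of [F xi] and the second is the noise.
    Taking means, where [gs] averages to [grad f xstar = 0], gives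
    [eta D_f(xstar, x_t) <= D_h(xstar, x_t) - E D_h(xstar, x_{t+1}) + eta^2 sigma^2].
    Telescoping over [t < T] leaves [- E D_h(xstar, x_T)], which absorbs the extra
    term [t = T] of the sum because [eta D_f(xstar, x_T) <= D_h(xstar, x_T)] by
    relative smoothness.  The telescoping is a backward induction on the
    iterated integral, so it needs measurability of one step at a time only. *)
Require Import Defs.
From HB Require Import structures.
From mathcomp Require Import all_boot all_order all_algebra.
From mathcomp Require Import all_classical all_reals all_analysis.
From mathcomp Require Import measurable_realfun ring lra.
Import Order.TTheory GRing.Theory Num.Theory.
Import numFieldNormedType.Exports.
Local Open Scope classical_set_scope.
Local Open Scope ring_scope.

(** * Inner product, one-sided directional derivatives and Bregman identities *)

Section BregmanCalculus.
Context {R : realType} {d : nat}.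
Implicit Types (u v w x y z : 'rV[R]_d) (phi psi : 'rV[R]_d -> R) (A : set 'rV[R]_d).

Lemma dotpC u v : dotp u v = dotp v u.
Proof. by apply: eq_bigr => i _; rewrite mulrC. Qed.

Lemma dotpDl u v w : dotp (u + v) w = dotp u w + dotp v w.
Proof. by rewrite -big_split; apply: eq_bigr => i _; rewrite !mxE mulrDl. Qed.

Lemma dotpZl (a : R) u v : dotp (a *: u) v = a * dotp u v.
Proof. by rewrite /dotp mulr_sumr; apply: eq_bigr => i _; rewrite !mxE mulrA. Qed.

Lemma dotpNl u v : dotp (- u) v = - dotp u v.
Proof. by rewrite -scaleN1r dotpZl mulN1r. Qed.

Lemma dotpDr u v w : dotp u (v + w) = dotp u v + dotp u w.
Proof. by rewrite dotpC dotpDl !(dotpC u). Qed.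

Lemma dotpZr (a : R) u v : dotp u (a *: v) = a * dotp u v.
Proof. by rewrite dotpC dotpZl dotpC. Qed.

Lemma dotpNr u v : dotp u (- v) = - dotp u v.
Proof. by rewrite dotpC dotpNl dotpC. Qed.

Definition dotpE := (dotpDl, dotpDr, dotpNl, dotpNr, dotpZl, dotpZr).

Lemma dotp_delta u (i : 'I_d) : dotp u (delta_mx 0 i) = u 0 i.
Proof.
rewrite /dotp (bigD1 i)//= big1 ?addr0; first by rewrite mxE !eqxx mulr1.
by move=> j /negPf ji; rewrite mxE ji andbF mulr0.
Qed.

Lemma dotp_continuous u : continuous (fun w => dotp w u).
Proof.
rewrite /dotp; apply: continuous_big => [|i _ w]; [exact: add_continuous|].
have cw : (v 0 i @[v --> w] --> w 0 i)%classic by exact: coord_continuous.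
exact: (cvgM cw (cvg_cst (u 0 i))).
Qed.

Lemma normr_coord_le u (i : 'I_d) : `|u 0 i| <= `|u|.
Proof.
rewrite [leRHS]/Num.Def.normr /= mx_normrE.
exact: (le_bigmax _ (fun ij => `|u ij.1 ij.2|) (0, i)).
Qed.

(** The norm on row vectors is the largest absolute value of a coordinate, hence the factor [d] in
    place of Cauchy-Schwarz. *)
Lemma dotp_le_norm u v : dotp u v <= d%:R * (`|u| * `|v|).
Proof.
rewrite -[X in X%:R * _](card_ord d) mulr_natl -sumr_const; apply: ler_sum => i _.
by rewrite (le_trans (ler_norm _))// normrM ler_pM// normr_coord_le.
Qed.

Lemma derive_grad phi z v : differentiable phi z ->
  'D_v phi z = dotp (grad phi z) v.
Proof.
move=> dphi; rewrite deriveE// [in LHS](row_sum_delta v) linear_sum.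
by apply: eq_bigr => i _; rewrite linearZ !mxE deriveE// mulrC.
Qed.

(** The limit is taken from the right because convexity and minimality are tested along segments
    with [t > 0]. *)
Lemma derive_cvg_right phi z v : differentiable phi z ->
  t^-1 * (phi (z + t *: v) - phi z) @[t --> 0^'+] --> dotp (grad phi z) v.
Proof.
move=> dphi; rewrite -derive_grad//.
have -> : (fun t => t^-1 * (phi (z + t *: v) - phi z)) =
    (fun t => t^-1 *: ((phi \o shift z) (t *: v) - phi z)).
  by apply/funext => t /=; rewrite (addrC z).
by apply: cvg_dnbhs_at_right; exact: diff_derivable.
Qed.

Lemma ge_grad_right phi z v (c : R) : differentiable phi z ->
  (\forall t \near 0^'+, c <= t^-1 * (phi (z + t *: v) - phi z)) ->
  c <= dotp (grad phi z) v.
Proof.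
move=> dphi cle; have cv := derive_cvg_right phi z v dphi.
by rewrite -(cvg_lim _ cv)//; apply: limr_ge => //; apply/cvg_ex; eexists; exact: cv.
Qed.

Lemma le_grad_right phi z v (c : R) : differentiable phi z ->
  (\forall t \near 0^'+, t^-1 * (phi (z + t *: v) - phi z) <= c) ->
  dotp (grad phi z) v <= c.
Proof.
move=> dphi cle; have cv := derive_cvg_right phi z v dphi.
by rewrite -(cvg_lim _ cv)//; apply: limr_le => //; apply/cvg_ex; eexists; exact: cv.
Qed.

(** By convexity every difference quotient of [phi] at [y] along [x - y] with [0 < t <= 1] is at
    most [phi x - phi y]; then [t] tends to 0. *)
Lemma bregman_ge0 A phi x y : convex_on A phi -> A x -> A y ->
  differentiable phi y -> 0 <= bregman phi x y.
Proof.
move=> cphi Ax Ay dphi; rewrite subr_ge0; apply: le_grad_right => //.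
near=> t; have t0 : 0 < t by near: t; exact: nbhs_right_gt.
have t1 : t <= 1 by near: t; exact: nbhs_right_le.
have := cphi x y t Ax Ay; rewrite (ltW t0) t1 => /(_ isT).
have -> : t *: x + (1 - t) *: y = y + t *: (x - y).
  by rewrite scalerBl scale1r scalerBr addrCA.
move=> le; rewrite -[leRHS](mulKf (lt0r_neq0 t0)) ler_pM2l ?invr_gt0//.
lra.
Unshelve. all: by end_near. Qed.

Lemma bregman_three_points phi x y z : bregman phi x z =
  bregman phi x y + bregman phi y z + dotp (grad phi y - grad phi z) (x - y).
Proof. by rewrite /bregman !dotpE; ring. Qed.

Lemma bregmanD_sym phi x y :
  bregman phi x y + bregman phi y x = dotp (grad phi x - grad phi y) (x - y).
Proof. by rewrite /bregman !dotpE; ring. Qed.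

End BregmanCalculus.

(** * Legendre duality and the one-step inequality *)

(** Collects in real-valued form the duality facts used below, so that infinite values of [h] and
    [conjugate h] stay out of the arguments. *)
Record legendre_pair {R : realType} {d : nat} (A : set 'rV[R]_d)
    (phi psi : 'rV[R]_d -> R) : Prop := {
  fenchel_young : forall w y, A w -> dotp w y - phi w <= psi y;
  legendre_eq : forall a, A a ->
    psi (grad phi a) = dotp a (grad phi a) - phi a;
  legendre_uniq : forall w a, A w -> A a ->
    dotp w (grad phi a) - phi w = psi (grad phi a) -> w = a;
  legendre_surj : forall y, exists2 z, A z & grad phi z = y }.

Arguments fenchel_young {R d A phi psi}.
Arguments legendre_eq {R d A phi psi}.
Arguments legendre_uniq {R d A phi psi}.
Arguments legendre_surj {R d A phi psi}.

Section LegendrePair.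
Context {R : realType} {d : nat} {A : set 'rV[R]_d} {phi psi : 'rV[R]_d -> R}.
Hypotheses (openA : open A) (phi_convex : convex_on A phi).
Hypothesis phi_diff : forall z, A z -> differentiable phi z.
Hypothesis phi_psi : legendre_pair A phi psi.
Implicit Types (a b u v w x y z : 'rV[R]_d) (F : 'rV[R]_d -> R).

(* On a small sphere around [a] the gap [phi w - phi a - dotp (w - a) (grad phi a)]
   has a positive minimum [m]; a preimage of a nearby slope lying outside the
   sphere would force, by convexity along the segment to [a], a smaller gap. *)
Lemma grad_inverse_continuous a (e : R) : A a -> 0 < e ->
  exists2 delta : R, 0 < delta & forall z, A z ->
    `|grad phi z - grad phi a| < delta -> `|z - a| < e.
Proof.
move=> Aa e0; set y := grad phi a.
have /nbhs_ballP[r0 /= r00 ballA] : nbhs a A by exact: open_nbhs_nbhs.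
pose r := Num.min e r0 / 2.
have r_gt0 : 0 < r by rewrite divr_gt0// lt_min e0.
have r_lt : r < Num.min e r0.
  by rewrite /r; have : 0 < Num.min e r0 by [rewrite lt_min e0]; lra.
have re : r < e by rewrite (lt_le_trans r_lt)// ge_min lexx.
have rr0 : r < r0 by rewrite (lt_le_trans r_lt)// ge_min lexx orbT.
pose S := [set w : 'rV[R]_d | `|w - a| = r].
have SA w : S w -> A w.
  by move=> Sw; apply: ballA; rewrite -ball_normE /= distrC Sw.
have S_closed : closed S.
  have -> : S = (fun w : 'rV[R]_d => `|w - a|) @^-1` [set r] by [].
  apply: preimage_closed; last exact: closed_eq.
  move=> w _.
  have wa : (v - a @[v --> w] --> w - a)%classic by exact: (cvgB cvg_id (cvg_cst a)).
  exact: (cvg_norm wa).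
have S_compact : compact S.
  apply: bounded_closed_compact => //.
  exists (`|a| + r); split => [|M aM w Sw]; first exact: num_real.
  by rewrite /= -(subrK a w) (le_trans (ler_normD _ _))// Sw addrC ltW.
pose G w := phi w - dotp w y.
have G_cont : {within S, continuous G}.
  apply: continuous_in_subspaceT => w /set_mem /SA Aw.
  have phiw : (phi v @[v --> w] --> phi w)%classic.
    exact/differentiable_continuous/phi_diff.
  exact: (cvgB phiw (dotp_continuous y w)).
have [m m0 Gm] : exists2 m, 0 < m & forall w, S w -> m <= G w - G a.
  (* In dimension 0 the sphere is empty, and any positive [m] serves. *)
  have [S0|/set0P/negP/negPn/eqP S0] := pselect (S !=set0); last first.
    by exists 1 => // w; rewrite S0.
  have [c /set_mem Sc cmin] := compact_EVT_min S0 S_compact G_cont.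
  exists (G c - G a); last first.
    by move=> w Sw; rewrite lerB// cmin// inE.
  rewrite subr_gt0 lt_neqAle; apply/andP; split; last first.
    have := fenchel_young phi_psi c y (SA _ Sc).
    by rewrite (legendre_eq phi_psi)// /G /y; lra.
  apply/eqP => Gac; have ca : c = a.
    apply: (legendre_uniq phi_psi) => //; first exact: SA.
    by move: Gac; rewrite (legendre_eq phi_psi)// /G /y; lra.
  by move: Sc; rewrite /S /= ca subrr normr0 => r_eq0; rewrite -r_eq0 ltxx in r_gt0.
(* The term [d%:R * r] comes from [dotp_le_norm] on a vector of norm [r]; adding 1 keeps the divisor
   positive in dimension 0. *)
have K0 : 0 < d%:R * r + 1 by rewrite ltr_wpDl// mulr_ge0// ltW.
exists (m / (d%:R * r + 1)); first by rewrite divr_gt0.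
move=> z Az; rewrite ltr_pdivlMr// => yz; rewrite ltNge; apply/negP => ez.
have za0 : 0 < `|z - a| by rewrite (lt_le_trans e0).
pose t := r / `|z - a|; pose w := t *: z + (1 - t) *: a.
have t0 : 0 < t by rewrite divr_gt0.
have t1 : t <= 1 by rewrite ler_pdivrMr// mul1r (le_trans (ltW re)).
have wa : w - a = t *: (z - a).
  by rewrite /w scalerBl scale1r scalerBr addrCA addrAC subrr add0r.
have Sw : S w by rewrite /S /= wa normrZ gtr0_norm// /t divfK// gt_eqF.
have := phi_convex z a t Az Aa; rewrite (ltW t0) t1 -/w => /(_ isT) cvx.
have := Gm w Sw; have := fenchel_young phi_psi a (grad phi z) Aa.
have wE p : dotp w p = dotp a p + t * (dotp z p - dotp a p).
  by rewrite -[w](subrK a) wa !dotpE; ring.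
rewrite (legendre_eq phi_psi)// /G !wE => fy gap.
have dz : t * (dotp z (grad phi z - y) - dotp a (grad phi z - y)) < m.
  have -> : t * (dotp z (grad phi z - y) - dotp a (grad phi z - y)) =
      dotp (w - a) (grad phi z - y) by rewrite wa !dotpE; ring.
  apply: le_lt_trans (dotp_le_norm _ _) _; rewrite Sw mulrA.
  apply: le_lt_trans yz; rewrite mulrC ler_wpM2l// lerDl//.
move: dz; rewrite !dotpE; nra.
Qed.

(** With [z] the preimage of the slope [grad phi a + t e_i], Fenchel-Young at [a] and at [z] puts
    the increment of [psi] between [t a_i] and [t z_i]. Continuity of the inverse gradient sends [z]
    to [a], so the partial derivative exists and equals [a_i]. *)
Lemma grad_conjugate a : A a -> grad psi (grad phi a) = a.
Proof.
move=> Aa; apply/rowP => i; rewrite mxE; set y := grad phi a.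
apply: cvg_lim => //; apply/cvgrPdist_lt => e e0.
have [delta delta0 Hdelta] := grad_inverse_continuous a e Aa e0.
pose K : R := `|delta_mx 0 i : 'rV[R]_d|.
have K0 : 0 < K + 1 by rewrite ltr_wpDl// normr_ge0.
near=> t.
have t0 : t != 0 by near: t; exact: nbhs_dnbhs_neq.
have td : `|t| < delta / (K + 1) by near: t; apply: dnbhs0_lt; rewrite divr_gt0.
rewrite /=; have [z Az zE] := legendre_surj phi_psi (t *: delta_mx 0 i + y).
have za : `|z 0 i - a 0 i| < e.
  have -> : z 0 i - a 0 i = (z - a) 0 i by rewrite !mxE.
  apply: le_lt_trans (normr_coord_le _ _) _; apply: Hdelta => //.
  rewrite zE addrK normrZ -/K; move: td; rewrite ltr_pdivlMr//.
  by apply: le_lt_trans; rewrite ler_wpM2l// lerDl.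
have lo := fenchel_young phi_psi a (grad phi z) Aa.
have hi := fenchel_young phi_psi z y Az.
have Ey := legendre_eq phi_psi a Aa; have Ez := legendre_eq phi_psi z Az.
rewrite -zE; move: lo hi; rewrite -/y in Ey.
rewrite Ez Ey zE !dotpE !dotp_delta => lo hi.
set D := (X in _ *: X); rewrite /GRing.scale /=.
have Dlo : t * a 0 i <= D by rewrite /D; lra.
have Dhi : D <= t * z 0 i by rewrite /D; lra.
move: D Dlo Dhi => D Dlo Dhi.
apply: le_lt_trans za; rewrite distrC -(@ler_pM2l _ `|t|) ?normr_gt0//.
rewrite -!normrM !mulrBr mulVKf//.
by rewrite !ger0_norm; lra.
Unshelve. all: by end_near. Qed.

(** The tangent of [psi] at [grad phi b] is the affine function given by [b], so this divergence is
    the Fenchel-Young gap of [b] and [u]. *)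
Lemma bregman_conjugate u b : A b ->
  bregman psi u (grad phi b) = psi u - (dotp b u - phi b).
Proof.
move=> Ab; rewrite /bregman grad_conjugate// (legendre_eq phi_psi)//.
by rewrite !dotpE; ring.
Qed.

Lemma bregman_conjugate_ge0 u b : A b -> 0 <= bregman psi u (grad phi b).
Proof.
by move=> Ab; rewrite bregman_conjugate// subr_ge0; exact: fenchel_young phi_psi _ _ Ab.
Qed.

Lemma bregman_conjugate_swap a b : A a -> A b ->
  bregman psi (grad phi a) (grad phi b) = bregman phi b a.
Proof.
move=> Aa Ab; rewrite bregman_conjugate// (legendre_eq phi_psi)// /bregman.
by rewrite !dotpE !(dotpC (grad phi a)); ring.
Qed.

(** At the midpoint [psi] agrees with the affine function given by [z], which lies below [psi] at
    [u] and at [v]. *)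
Lemma conjugate_midpoint u v :
  psi (2^-1 *: (u + v)) <= 2^-1 * psi u + 2^-1 * psi v.
Proof.
have [z Az zE] := legendre_surj phi_psi (2^-1 *: (u + v)).
have := legendre_eq phi_psi z Az; rewrite zE => ->.
have := fenchel_young phi_psi z u Az; have := fenchel_young phi_psi z v Az.
rewrite !dotpE; lra.
Qed.

(** Let [z] be the mirror step from [x] along [grad F x - grad F y]. Expand [0 <= bregman F z y]
    through [x]: smoothness bounds [bregman F z x], and the inner product is [- gamma^-1] times the
    symmetrized divergence of [phi]. Since [gamma * L <= 1], only [bregman phi x z] survives, which
    is the left side by duality. *)
Lemma bregman_cocoercive F (L gamma : R) x y : convex_on A F ->
  (forall z, A z -> differentiable F z) -> rel_smooth A L F phi ->
  0 < gamma -> gamma * L <= 1 -> A x -> A y ->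
  bregman psi (grad phi x - gamma *: (grad F x - grad F y)) (grad phi x) <=
  gamma * bregman F x y.
Proof.
move=> F_convex F_diff F_smooth gamma0 gammaL Ax Ay.
have [z Az zE] := legendre_surj phi_psi (grad phi x - gamma *: (grad F x - grad F y)).
rewrite -zE bregman_conjugate_swap//.
have Fzy : 0 <= bregman F z y by apply: (bregman_ge0 A) => //; exact: F_diff.
have Fzx := F_smooth z x Az Ax.
have phizx : 0 <= bregman phi z x by apply: (bregman_ge0 A) => //; exact: phi_diff.
have phi_sym := bregmanD_sym phi z x.
rewrite (bregman_three_points F z x y) in Fzy; rewrite zE in phi_sym.
move: phi_sym; rewrite [X in dotp X _]addrAC subrr add0r dotpNl dotpZl => phi_sym.
nra.
Qed.

Lemma bregman_step F (L eta : R) x xs xn : convex_on A F ->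
  (forall z, A z -> differentiable F z) -> rel_smooth A L F phi ->
  0 < eta -> (2 * eta) * L <= 1 -> A x -> A xs -> A xn ->
  grad phi xn = grad phi x - eta *: grad F x ->
  bregman phi xs xn <= bregman phi xs x - eta * bregman F xs x
    - eta * dotp (grad F xs) (x - xs)
    + 2^-1 * bregman psi (grad phi x - (2 * eta) *: grad F xs) (grad phi x).
Proof.
move=> F_convex F_diff F_smooth eta0 etaL Ax Axs Axn xnE.
have eta2 : 0 < 2 * eta by rewrite mulr_gt0.
(* The midpoint splitting doubles each half of the step, so cocoercivity is used with [2 * eta];
   this is the source of the bound [eta <= (2 * L)^-1]. *)
have := bregman_cocoercive F L (2 * eta) x xs F_convex F_diff F_smooth eta2 etaL Ax Axs.
rewrite (bregman_three_points phi xs x xn) -(bregman_conjugate_swap _ _ Axn Ax) xnE.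
have := conjugate_midpoint (grad phi x - (2 * eta) *: (grad F x - grad F xs))
   (grad phi x - (2 * eta) *: grad F xs).
have -> : 2^-1 *: (grad phi x - (2 * eta) *: (grad F x - grad F xs) +
    (grad phi x - (2 * eta) *: grad F xs)) = grad phi x - eta *: grad F x.
  by apply/rowP => i; rewrite !mxE; field.
rewrite !bregman_conjugate// => mid coco.
(* Symmetrization turns [bregman F x xs - dotp (grad F x) (x - xs)] into the two negative terms of
   the claim. *)
have FE := congr1 ( *%R eta) (bregmanD_sym F x xs).
move: mid coco FE; rewrite !dotpE !(dotpC x) => mid coco FE.
lra.
Qed.

End LegendrePair.

(** * The Legendre pair supplied by the standing assumption *)

Lemma near_right_segment {R : realType} {d : nat} (A : set 'rV[R]_d)
    (z v : 'rV[R]_d) :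
  nbhs z A -> \forall t \near (0 : R)^'+, A (z + t *: v).
Proof.
have zv : (z + t *: v @[t --> (0 : R)^'+] --> z)%classic.
  have : (z + t *: v @[t --> (0 : R)^'+] --> z + 0 *: v)%classic.
    apply: cvg_at_right_filter.
    have tv : (t *: v @[t --> (0 : R)] --> 0 *: v)%classic.
      by apply: cvgZr_tmp; exact: cvg_id.
    exact: (cvgD (cvg_cst z) tv).
  by rewrite scale0r addr0.
exact: zv.
Qed.

(** For each slope [y] the minimizer of [h w - dotp w y] is interior, so it satisfies the
    first-order condition and realizes the conjugate as a finite maximum. *)
Lemma legendre_pair_conjugate {R : realType} {d : nat} (C : set 'rV[R]_d)
    (h : 'rV[R]_d -> \bar R) (hR := fun z => fine (h z)) :
  (forall z, ~ C z -> h z = +oo%E) ->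
  (forall z, interior C z -> h z \is a fin_num) ->
  (forall z, interior C z -> differentiable hR z) ->
  convex_on (interior C) hR ->
  (forall y : 'rV[R]_d, exists z, [/\ C z,
      (forall w, C w -> (h z - (dotp z y)%:E <= h w - (dotp w y)%:E)%E),
      (forall w, C w ->
         (forall w', C w' -> (h w - (dotp w y)%:E <= h w' - (dotp w' y)%:E)%E) ->
         w = z) &
      interior C z]) ->
  legendre_pair (interior C) hR (fun y => fine (conjugate h y)).
Proof.
move=> h_out h_fin h_diff h_convex h_min.
have hE z : interior C z -> h z = (hR z)%:E by move=> /h_fin/fineK.
have minP y : exists z, [/\ interior C z, grad hR z = y,
    conjugate h y = (dotp z y - hR z)%:E &
    forall w, interior C w -> dotp w y - hR w = dotp z y - hR z -> w = z].
  have [z [Cz zmin zuniq iz]] := h_min y; exists z; split => //.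
  (* Comparing [z] with [z + t *: v] gives one inequality per direction; the basis vectors and their
     opposites give equality of coordinates. *)
  - have dir v : dotp y v <= dotp (grad hR z) v.
      apply: ge_grad_right; first exact: h_diff.
      have zC : nbhs z (interior C) by exact: nbhs_interior.
      near=> t; have t0 : 0 < t by near: t; exact: nbhs_right_gt.
      have zt : interior C (z + t *: v) by near: t; exact: near_right_segment.
      have := zmin _ (interior_subset zt); rewrite !hE//= lee_fin !dotpE => le.
      by rewrite ler_pdivlMl// dotpC; lra.
    apply/rowP => i; apply/eqP; rewrite eq_le -!dotp_delta dir andbT.
    by have := dir (- delta_mx 0 i); rewrite !dotpNr lerN2.
  - apply/eqP; rewrite eq_le; apply/andP; split; last first.
      by apply: ereal_sup_ubound; exists z => //; rewrite hE.
    apply: ge_ereal_sup => _ [w _ <-].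
    have [Cw|Cw] := pselect (C w); last by rewrite h_out// leNye.
    have := zmin w Cw; rewrite hE//; case: (h w) => [r||] //=; rewrite ?leNye//.
    by rewrite !lee_fin; lra.
  - move=> w iw wE; apply: zuniq; first exact: interior_subset.
    move=> w' Cw'; apply: le_trans (zmin w' Cw').
    by rewrite !hE// lee_fin; lra.
have gradP a : interior C a ->
    conjugate h (grad hR a) = (dotp a (grad hR a) - hR a)%:E /\
    forall w, interior C w ->
      dotp w (grad hR a) - hR w = dotp a (grad hR a) - hR a -> w = a.
  move=> ia; have [z [iz zE cz zuniq]] := minP (grad hR a).
  suff -> : a = z by rewrite -zE in cz zuniq *.
  apply: zuniq => //.
  (* As the gradients at [a] and [z] agree, the two divergences sum to 0. Both vanish, so [a]
     attains the same value as the minimizer [z]. *)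
  have := bregman_ge0 (interior C) hR a z h_convex ia iz (h_diff z iz).
  have := bregman_ge0 (interior C) hR z a h_convex iz ia (h_diff a ia).
  by rewrite /bregman zE !dotpE !(dotpC (grad hR a)); lra.
split.
- move=> w y iw; have [z [iz zE cz _]] := minP y; rewrite cz/=.
  have := bregman_ge0 (interior C) hR w z h_convex iw iz (h_diff z iz).
  by rewrite /bregman zE !dotpE !(dotpC y); lra.
- by move=> a /gradP[->].
- by move=> w a iw /gradP[-> +] => /(_ w iw).
- by move=> y; have [z [iz zE _ _]] := minP y; exists z.
Unshelve. all: by end_near. Qed.

(** * Measurability of the conjugate, and monotonicity of the integral *)

Section CountableSupremum.
Context {R : realType} {d : nat} {A : set 'rV[R]_d} {phi psi : 'rV[R]_d -> R}.
Hypotheses (openA : open A) (phi_diff : forall z, A z -> differentiable phi z).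
Hypothesis phi_psi : legendre_pair A phi psi.

Lemma rational_row_dense (B : set 'rV[R]_d) : open B -> B !=set0 ->
  exists q : 'rV[rat]_d, B (map_mx ratr q).
Proof.
move=> openB [z Bz].
have /nbhs_ballP[r /= r0 ballB] : nbhs z B by exact: open_nbhs_nbhs.
have /choice[q qz] : forall i, exists q : rat, ball (z 0 i) r (ratr q : R).
  move=> i; have /rat_in_itvoo[q] : z 0 i - r < z 0 i + r by lra.
  rewrite in_itv/= => /andP[lo hi]; exists q.
  by rewrite -ball_normE /= ltr_norml; lra.
exists (\row_i q i); apply: ballB; split => // i j.
by rewrite !mxE ord1; exact: qz.
Qed.

(** The supremum is attained at an interior [z]; a strict inequality there persists nearby, hence at
    a rational point. The preimage of a ray is thus a countable union of measurable sets. *)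
Lemma measurable_legendre {dX : measure_display} {X : measurableType dX}
    (u : X -> 'rV[R]_d) :
  (forall i, measurable_fun [set: X] (fun xi => u xi 0 i)) ->
  measurable_fun [set: X] (fun xi => psi (u xi)).
Proof.
move=> mu mD; apply: (measurability _ (RGenOInfty.measurableE R)) => //.
move=> _ [_ [a ->] <-]; rewrite setTI.
pose g (q : 'rV[rat]_d) xi := dotp (map_mx ratr q) (u xi) - phi (map_mx ratr q).
pose Q := [set q : 'rV[rat]_d | A (map_mx ratr q)].
have -> : (fun xi => psi (u xi)) @^-1` `]a, +oo[%classic =
    \bigcup_(q in Q) (g q @^-1` `]a, +oo[%classic).
  apply/seteqP; split => xi /=; last first.
    move=> [q Aq]; rewrite /= !in_itv/= !andbT => /lt_le_trans; apply.
    exact: fenchel_young phi_psi _ _ Aq.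
  rewrite in_itv/= andbT => aps.
  have [z Az zE] := legendre_surj phi_psi (u xi).
  have cz : {for z, continuous (fun w => dotp w (u xi) - phi w)}.
    have phiz : (phi v @[v --> z] --> phi z)%classic.
      exact/differentiable_continuous/phi_diff.
    exact: (cvgB (dotp_continuous (u xi) z) phiz).
  have az : a < dotp z (u xi) - phi z.
    by move: aps; rewrite -zE (legendre_eq phi_psi).
  have : nbhs z (A `&` [set w | a < dotp w (u xi) - phi w]).
    apply: filterI; first exact: open_nbhs_nbhs.
    by apply: (cz [set r | a < r]); apply: open_nbhs_nbhs; split => //; exact: open_gt.
  move=> /nbhs_interior zB.
  have [q /interior_subset[Aq aq]] := rational_row_dense _
    (open_interior (A `&` [set w | a < dotp w (u xi) - phi w]))
    (ex_intro _ z (nbhs_singleton zB)).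
  by exists q => //=; rewrite in_itv/= andbT.
rewrite bigcup_mkcond; apply: countable_bigcupT_measurable => [|q].
  exact: countableP.
case: ifPn => // _.
have mg : measurable_fun [set: X] (g q).
  apply: measurable_funB => //; apply: measurable_sum => i.
  by apply: measurable_funM.
by rewrite -[X in measurable X]setTI; exact: mg.
Qed.

End CountableSupremum.

(* The integral of [f] is the difference of two suprema over simple functions
   below [f^+] and [f^-], hence monotone even for non-measurable functions. *)
Lemma le_integral_nomeas {dX : measure_display} {X : measurableType dX}
    {R : realType} (mu : {measure set X -> \bar R}) (f g : X -> \bar R) :
  (forall x, (f x <= g x)%E) ->
  (\int[mu]_x f x <= \int[mu]_x g x)%E.
Proof.
move=> fg; have nn (u v : X -> \bar R) : (forall x, 0 <= u x)%E ->
    (forall x, u x <= v x)%E -> (\int[mu]_x u x <= \int[mu]_x v x)%E.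
  move=> u0 uv; rewrite !ge0_integralTE//; last by move=> x; exact: le_trans (uv x).
  apply: le_ereal_sup => _ [k /= ku <-]; exists k => // x.
  exact: le_trans (ku x) (uv x).
rewrite integralE [leRHS]integralE leeB//; apply: nn => // x.
- by apply: (@funepos_le _ _ [set: X]) => [y _|]; rewrite ?inE.
- by apply: (@funeneg_le _ _ [set: X]) => [y _|]; rewrite ?inE.
Qed.

(** * Means of real random variables and of gradients *)

(** Integrability and the real value of the integral are bundled so that linear rules carry no side
    conditions. *)
Definition has_mean {dX : measure_display} {X : measurableType dX} {R : realType}
    (P : probability X R) (g : X -> R) (m : R) : Prop :=
  P.-integrable [set: X] (fun xi => (g xi)%:E) /\
  (\int[P]_xi (g xi)%:E)%E = m%:E.

Section Means.
Context {dX : measure_display} {X : measurableType dX} {R : realType}.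
Variable P : probability X R.
Implicit Types (g k : X -> R) (a b : R).

Lemma has_mean_integrable g : P.-integrable [set: X] (fun xi => (g xi)%:E) ->
  exists m, has_mean P g m.
Proof.
move=> ig; exists (fine (\int[P]_xi (g xi)%:E)%E); split => //.
by rewrite fineK//; exact: integrable_fin_num.
Qed.

Lemma has_mean_cst a : has_mean P (fun=> a) a.
Proof.
split; first exact: finite_measure_integrable_cst.
by rewrite (integral_cst P)// [X in (_ * X)%E]probability_setT mule1.
Qed.

Lemma has_meanD g k a b : has_mean P g a -> has_mean P k b ->
  has_mean P (fun xi => g xi + k xi) (a + b).
Proof.
move=> [ig ga] [ik kb]; split.
  by under eq_fun do rewrite EFinD; exact: integrableD.
by rewrite integralD_EFin// ga kb.
Qed.

Lemma has_meanZ g a b : has_mean P g a -> has_mean P (fun xi => b * g xi) (b * a).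
Proof.
move=> [ig ga]; split.
  by under eq_fun do rewrite EFinM; exact: integrableZl.
by under eq_integral do rewrite EFinM; rewrite integralZl// ga.
Qed.

Lemma has_meanB g k a b : has_mean P g a -> has_mean P k b ->
  has_mean P (fun xi => g xi - k xi) (a - b).
Proof.
move=> ga kb; rewrite -mulN1r.
by under eq_fun do rewrite -mulN1r; apply: has_meanD => //; exact: has_meanZ.
Qed.

Lemma has_mean_le g k a b : has_mean P g a -> has_mean P k b ->
  (forall xi, g xi <= k xi) -> a <= b.
Proof.
move=> [ig ga] [ik kb] gk; rewrite -lee_fin -ga -kb.
by apply: le_integral => // xi _; rewrite lee_fin.
Qed.

(** A finite bound on the integral of a nonnegative function already makes it integrable; this
    extracts a real mean from the noise assumption. *)
Lemma has_mean_ge0 g (c s : R) : measurable_fun [set: X] g ->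
  (forall xi, 0 <= g xi) -> 0 < c ->
  (c%:E * \int[P]_xi (g xi)%:E <= s%:E)%E -> exists2 m, has_mean P g m & c * m <= s.
Proof.
move=> mg g0 c0 gs.
have I0 : (0 <= \int[P]_xi (g xi)%:E)%E by apply: integral_ge0 => xi _; rewrite lee_fin.
have fin : (\int[P]_xi (g xi)%:E < +oo)%E.
  rewrite ltey; apply/eqP => Ioo; move: gs; rewrite Ioo.
  by rewrite gt0_muley// lee_fin.
have ig : P.-integrable [set: X] (fun xi => (g xi)%:E).
  apply/integrableP; split; first exact/measurable_EFinP.
  by under eq_integral do rewrite gee0_abs ?lee_fin//.
have [m [_ mE]] := has_mean_integrable g ig; exists m; first by split.
by move: gs; rewrite mE -EFinM lee_fin.
Qed.

End Means.

(* Convexity makes the difference quotients dominate the slope, so the mean of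
   the slope is at most every difference quotient of the mean; doing the same
   for [- v] replaces differentiation under the integral sign. *)
Lemma has_mean_grad {R : realType} {d : nat} {dX : measure_display}
    {X : measurableType dX} (P : probability X R) (A : set 'rV[R]_d)
    (F : X -> 'rV[R]_d -> R) (f : 'rV[R]_d -> R) (z v : 'rV[R]_d) :
  open A -> (forall w, A w -> has_mean P (F ^~ w) (f w)) ->
  (forall xi, convex_on A (F xi)) ->
  (forall xi w, A w -> differentiable (F xi) w) ->
  (forall i, measurable_fun [set: X] (fun xi => grad (F xi) z 0 i)) ->
  A z -> differentiable f z ->
  has_mean P (fun xi => dotp (grad (F xi) z) v) (dotp (grad f z) v).
Proof.
move=> openA mF F_convex F_diff mgrad Az df.
have zA : nbhs z A by exact: open_nbhs_nbhs.
have slope u xi t : 0 < t -> A (z + t *: u) ->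
    dotp (grad (F xi) z) u <= t^-1 * (F xi (z + t *: u) - F xi z).
  move=> t0 At; rewrite ler_pdivlMl// -dotpZr.
  have := bregman_ge0 A (F xi) (z + t *: u) z (F_convex xi) At Az (F_diff xi z Az).
  by rewrite /bregman [X in dotp _ X]addrAC subrr add0r subr_ge0.
have quot u t : A (z + t *: u) ->
    has_mean P (fun xi => t^-1 * (F xi (z + t *: u) - F xi z))
      (t^-1 * (f (z + t *: u) - f z)).
  by move=> At; apply: has_meanZ; apply: has_meanB; exact: mF.
have [m mE] : exists m, has_mean P (fun xi => dotp (grad (F xi) z) v) m.
  apply: has_mean_integrable.
  (* For integrability, a single [t] feasible along both [v] and [- v] places the slope between
     [- lo] and [hi], so it is dominated by [|hi| + |lo|]. *)
  have [t [t0 tv tNv]] : exists t : R, [/\ 0 < t, A (z + t *: v) & A (z + t *: - v)].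
    have : \forall t \near (0 : R)^'+, [/\ 0 < t, A (z + t *: v) & A (z + t *: - v)].
      near=> t; split; near: t; [exact: nbhs_right_gt|exact: near_right_segment..].
    by move=> /filter_ex.
  have [+ _] := quot v t tv; have [+ _] := quot (- v) t tNv.
  set lo := (fun xi => t^-1 * (F xi (z + t *: - v) - F xi z)).
  set hi := (fun xi => t^-1 * (F xi (z + t *: v) - F xi z)).
  move=> /integrable_norm/= ilo /integrable_norm/= ihi.
  apply: (le_integrable _ _ _ (integrableD _ ihi ilo)) => //.
    apply/measurable_EFinP; apply: measurable_sum => i.
    by apply: measurable_funM => //; exact: mgrad.
  move=> xi _ /=; rewrite lee_fin [leRHS]ger0_norm; last by rewrite addr_ge0.
  have := slope v xi t t0 tv; have := slope (- v) xi t t0 tNv.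
  rewrite dotpNr -/(lo xi) -/(hi xi) => lo_le hi_le; rewrite ler_norml.
  have := ler_norm (lo xi); have := ler_norm (hi xi).
  have := normr_ge0 (lo xi); have := normr_ge0 (hi xi); lra.
suff <- : m = dotp (grad f z) v by [].
have dir u k : has_mean P (fun xi => dotp (grad (F xi) z) u) k -> k <= dotp (grad f z) u.
  move=> kE; apply: ge_grad_right => //; near=> t.
  have t0 : 0 < t by near: t; exact: nbhs_right_gt.
  have At : A (z + t *: u) by near: t; exact: near_right_segment.
  by apply: (has_mean_le P _ _ _ _ kE (quot u t At)) => xi; exact: slope.
apply/eqP; rewrite eq_le dir//= -lerN2 -dotpNr; apply: dir.
rewrite -mulN1r (_ : (fun _ => _) = (fun xi => -1 * dotp (grad (F xi) z) v)).
  exact: has_meanZ.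
by apply/funext => xi; rewrite dotpNr mulN1r.
Unshelve. all: by end_near. Qed.

(** * Telescoping along the iterated integral *)

(** Here [s] is the history so far, [b] the sum already accumulated and [n] the number of samples
    left. Both [k] and [b] stay inside the integral: the integrand is handled by monotonicity alone,
    and linearity is applied only to the integrable majorant [G]. *)
Lemma iexp_le_potential {R : realType} {dX : measure_display}
    {X : measurableType dX} (P : probability X R) (Phi delta : seq X -> R)
    (eta c : R) : 0 < eta ->
  (forall s, eta * delta s <= Phi s) ->
  (forall s, exists G m, [/\ has_mean P G m,
     forall xi, Phi (rcons s xi) <= G xi &
     m <= Phi s - eta * delta s + c]) ->
  forall (k : R) n s b, 0 <= k ->
  (iexp P n (fun r => (k * (b + \sum_(0 <= t < n.+1) delta (s ++ take t r)))%:E)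
   <= (k * (b + (Phi s + n%:R * c) / eta))%:E)%E.
Proof.
move=> eta0 last_le step k n s b k0.
elim: n s b => [|n IH] s b /=.
  (* With no sample left one term [delta s] remains, the extra last one; it is paid for by the
     remaining potential [Phi s]. *)
  rewrite big_nat1 cats0 lee_fin ler_wpM2l// lerD2l mul0r addr0.
  by rewrite ler_pdivlMr// mulrC.
have [G [m [mG PhiG m_le]]] := step s.
apply: (@le_trans _ _ (\int[P]_xi
    (k * (b + delta s + (G xi + n%:R * c) / eta))%:E)%E).
  apply: le_integral_nomeas => xi.
  (* The term [t = 0] moves into the accumulated sum, and the others are reindexed over the history
     [rcons s xi]. *)
  rewrite (_ : (fun r => _) = (fun r => (k * (b + delta s +
      \sum_(0 <= t < n.+1) delta (rcons s xi ++ take t r)))%:E)); last first.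
    apply/funext => r; rewrite big_nat_recl// take0 cats0 addrA.
    by under eq_bigr do rewrite /= -cat_rcons.
  apply: le_trans (IH (rcons s xi) (b + delta s)) _.
  by rewrite lee_fin ler_wpM2l// lerD2l ler_pM2r ?invr_gt0// lerD2r.
have [_ ->] : has_mean P (fun xi => k * (b + delta s + (G xi + n%:R * c) / eta))
    (k * (b + delta s + (m + n%:R * c) / eta)).
  apply: has_meanZ; apply: has_meanD; first exact: has_mean_cst.
  rewrite (mulrC _ eta^-1); under eq_fun do rewrite (mulrC _ eta^-1).
  by apply: has_meanZ; apply: has_meanD => //; exact: has_mean_cst.
(* Writing [delta s] as [delta s * eta / eta] cancels the [- eta * delta s] in the bound on [m]. *)
rewrite lee_fin ler_wpM2l// -addrA lerD2l -[X in X + _](mulfK (lt0r_neq0 eta0)).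
rewrite -mulrDl ler_pM2r ?invr_gt0// -natr1; lra.
Qed.

(** * The convergence bound *)

Theorem theorem3
  (R : realType) (d : nat)
  (C : set 'rV[R]_d) (h : 'rV[R]_d -> \bar R)
  (dX : measure_display) (Xi : measurableType dX) (P : probability Xi R)
  (F : Xi -> 'rV[R]_d -> R) (f : 'rV[R]_d -> R)
  (L eta sigma2 : R) (xstar x0 : 'rV[R]_d) (x : seq Xi -> 'rV[R]_d) :
  let hR := fun z => fine (h z) in
  let hstar := fun y => fine (conjugate h y) in
  (* standing assumption on C and h *)
  closed C -> convex_set C ->
  (forall z, h z != -oo%E) ->
  (forall z, ~ C z -> h z = +oo%E) ->
  (forall z, interior C z -> h z \is a fin_num) ->
  C2_on (interior C) hR ->
  strictly_convex_on (interior C) h ->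
  (forall y : 'rV[R]_d, exists z, [/\ C z,
      (forall w, C w -> (h z - (dotp z y)%:E <= h w - (dotp w y)%:E)%E),
      (forall w, C w ->
         (forall w', C w' -> (h w - (dotp w y)%:E <= h w' - (dotp w' y)%:E)%E) ->
         w = z) &
      interior C z]) ->
  (* the stochastic objective: f = E_xi[f_xi] *)
  (forall z, interior C z -> P.-integrable [set: Xi] (fun xi => (F xi z)%:E)) ->
  (forall z, interior C z -> (f z)%:E = (\int[P]_xi (F xi z)%:E)%E) ->
  (forall z, interior C z -> differentiable f z) ->
  0 < L -> rel_smooth (interior C) L f hR ->
  (* minimizer x* *)
  interior C xstar -> (forall z, interior C z -> f xstar <= f z) ->
  grad f xstar = 0 ->
  (* noise assumption *)
  (forall xi, convex_on (interior C) (F xi)) ->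
  (forall xi z, interior C z -> differentiable (F xi) z) ->
  (forall xi, rel_smooth (interior C) L (F xi) hR) ->
  (forall z (i : 'I_d), interior C z ->
     measurable_fun [set: Xi] (fun xi => grad (F xi) z 0 i)) ->
  0 <= sigma2 ->
  (forall s : seq Xi,
     ((2 * eta ^+ 2)^-1%:E *
       \int[P]_xi (bregman hstar (grad hR (x s) - (2 * eta) *: grad (F xi) xstar)
                                 (grad hR (x s)))%:E <= sigma2%:E)%E) ->
  (* step size *)
  0 < eta -> eta <= (2 * L)^-1 ->
  (* BSGD iterates: x [:: xi_0; ...; xi_(t-1)] = x_t *)
  interior C x0 -> x [::] = x0 ->
  (forall s xi, interior C (x (rcons s xi)) /\
     grad hR (x (rcons s xi)) = grad hR (x s) - eta *: grad (F xi) (x s)) ->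
  (forall (t : nat) (i : 'I_d),
     measurable_fun [set: t.-tuple Xi] (fun s : t.-tuple Xi => x (tval s) 0 i)) ->
  forall T : nat, (1 <= T)%N ->
  (iexp P T (fun s => ((T%:R)^-1 *
      \sum_(0 <= t < T.+1) bregman f xstar (x (take t s)))%:E)
   <= (bregman hR xstar x0 / (eta * T%:R) + eta * sigma2)%:E)%E.
Proof.
move=> hR hstar C_closed C_convex hNy h_out h_fin [h_diff _ _] h_sconvex h_min
  F_int fE f_diff L0 f_smooth ixs f_min gradfxs F_convex F_diff F_smooth mgradF
  sigma0 noise eta0 etaL ix0 x_nil x_step x_meas T T1.
have openI : open (interior C) := open_interior C.
have h_convex : convex_on (interior C) hR.
  move=> z w t iz iw /andP[t0 t1].
  have [->|zw] := eqVneq z w; first by rewrite -scalerDl -mulrDl subrKC scale1r mul1r.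
  have [->|t0'] := eqVneq t 0.
    by rewrite scale0r add0r subr0 scale1r mul0r mul1r add0r.
  have [->|t1'] := eqVneq t 1.
    by rewrite subrr scale0r addr0 scale1r mul0r mul1r addr0.
  have t01 : 0 < t < 1 by rewrite lt_def t0' t0 lt_neqAle t1' t1.
  have := h_sconvex z w t iz iw zw t01.
  rewrite -(fineK (h_fin z iz)) -(fineK (h_fin w iw)) -!EFinM -EFinD -/(hR z) -/(hR w).
  (* The strict inequality rules out [+oo] and [hNy] rules out [-oo], so [fine] preserves the
     comparison. *)
  have := hNy (t *: z + (1 - t) *: w); rewrite /hR.
  by case: (h (t *: z + (1 - t) *: w)) => [r||] //= _ /ltW; rewrite lee_fin.
have dual : legendre_pair (interior C) hR hstar by exact: legendre_pair_conjugate.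
have F_mean z : interior C z -> has_mean P (F ^~ z) (f z).
  by move=> iz; split; [exact: F_int|rewrite fE].
have ix s : interior C (x s).
  by case/lastP: s => [|s xi]; [rewrite x_nil|have [] := x_step s xi].
have eta2L : 2 * eta * L <= 1.
  by move: etaL; rewrite -[leRHS]mul1r ler_pdivlMr ?mulr_gt0//; lra.
pose Phi s := bregman hR xstar (x s); pose delta s := bregman f xstar (x s).
have Phi_ge0 s : 0 <= Phi s.
  by apply: (bregman_ge0 (interior C)) => //; exact: h_diff.
have last_le s : eta * delta s <= Phi s.
  have := f_smooth xstar (x s) ixs (ix s); have := Phi_ge0 s.
  by rewrite -/(Phi s) -/(delta s); nra.
have T0 : 0 < T%:R :> R by rewrite ltr0n.
have step s : exists G m, [/\ has_mean P G m, forall xi, Phi (rcons s xi) <= G xi &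
    m <= Phi s - eta * delta s + eta ^+ 2 * sigma2].
  pose N xi := bregman hstar (grad hR (x s) - (2 * eta) *: grad (F xi) xstar) (grad hR (x s)).
  have [n nE n_le] : exists2 n, has_mean P N n & (2 * eta ^+ 2)^-1 * n <= sigma2.
    apply: has_mean_ge0 (noise s).
    (* As a Fenchel-Young gap the noise is [hstar] at an affine image of the gradient minus an
       affine function of that image; both are measurable. *)
    - rewrite /N; under eq_fun do rewrite (bregman_conjugate openI h_convex h_diff dual)//.
      have mu i : measurable_fun [set: Xi]
          (fun xi => (grad hR (x s) - (2 * eta) *: grad (F xi) xstar) 0 i).
        rewrite (_ : (fun _ => _) = (fun xi =>
            grad hR (x s) 0 i - 2 * eta * grad (F xi) xstar 0 i)); last first.
          by apply/funext => xi; rewrite !mxE.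
        by apply: measurable_funB => //; apply: measurable_funM => //; exact: mgradF.
      apply: measurable_funB; first exact: (measurable_legendre openI h_diff dual).
      apply: measurable_funB => //; apply: measurable_sum => i.
      by apply: measurable_funM.
    - by move=> xi; exact: (bregman_conjugate_ge0 openI h_convex h_diff dual).
    - by rewrite invr_gt0 mulr_gt0// exprn_gt0.
  (* The majorant is the right side of [bregman_step], and the next witness is its mean. *)
  exists (fun xi => Phi s - eta * bregman (F xi) xstar (x s)
    - eta * dotp (grad (F xi) xstar) (x s - xstar) + 2^-1 * N xi).
  exists (Phi s - eta * delta s - eta * dotp (grad f xstar) (x s - xstar) + 2^-1 * n).
  have grad_mean z v : interior C z ->
      has_mean P (fun xi => dotp (grad (F xi) z) v) (dotp (grad f z) v).
    move=> iz; apply: (has_mean_grad P (interior C)) => //; last exact: f_diff.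
    by move=> i; exact: mgradF.
  split.
  - apply: has_meanD; last exact: has_meanZ.
    apply: has_meanB; last by apply: has_meanZ; exact: grad_mean.
    apply: has_meanB; first exact: has_mean_cst.
    apply: has_meanZ; apply: has_meanB; last exact: grad_mean.
    by apply: has_meanB; exact: F_mean.
  - move=> xi; have [ixn xnE] := x_step s xi.
    by apply: (bregman_step openI h_convex h_diff dual (F xi) L) => //; exact: F_diff.
  (* The inner product vanishes, and half of [n <= 2 * eta ^+ 2 * sigma2] is the allowed error. *)
  - rewrite gradfxs -(scale0r 0) dotpZl mul0r mulr0 subr0 lerD2l.
    move: n_le; rewrite mulrC ler_pdivrMr ?mulr_gt0// ?exprn_gt0//; lra.
have := iexp_le_potential P Phi delta eta _ eta0 last_le step T%:R^-1 T [::] 0.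
rewrite invr_ge0 ltW// => /(_ isT).
under [X in iexp _ _ X]eq_fun do rewrite add0r.
(* From the empty history, with weight [T%:R^-1], the potential bound equals the claimed one. *)
move=> /le_trans; apply; rewrite lee_fin /Phi x_nil add0r le_eqVlt; apply/orP; left.
by apply/eqP; field; rewrite !gt_eqF.
Qed.
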